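(* Let $\mathcal{B}$ be an abelian category with enough projective objects and enough injective objects, let $\mathsf{F}:\mathcal{B}\to\mathcal{B}$ be an additive right exact functor, let $\eta:\mathsf{F}^2\to\mathsf{F}$ be an associative natural transformation, and let $\mathcal{B}\ltimes_\eta\mathsf{F}$ be the $\eta$-extension of $\mathcal{B}$. Let $(\mathcal{X},\mathcal{Y})$ be a cotorsion pair in $\mathcal{B}$. (1) If $\mathbb{L}_1\mathsf{F}(X)=0$ for all $X\in\mathcal{X}$, then $({}^{\perp}\mathsf{U}^{-1}(\mathcal{Y}),\,\mathsf{U}^{-1}(\mathcal{Y}))$ is a cotorsion pair in $\mathcal{B}\ltimes_\eta\mathsf{F}$; moreover, it is hereditary if and only if $(\mathcal{X},\mathcal{Y})$ is hereditary. (2) If $\mathsf{F}^2=0$ (so that $\eta=0$), then $(\Delta(\mathcal{X}),\,\Delta(\mathcal{X})^{\perp})$ is a cotorsion pair in $\mathcal{B}\ltimes\mathsf{F}$. Moreover, if in addition $\mathbb{L}_1\mathsf{F}(X)=0$ for all $X\in\mathcal{X}$, then $(\Delta(\mathcal{X}),\Delta(\mathcal{X})^{\perp})$ is hereditary if and only if $(\mathcal{X},\mathcal{Y})$ is hereditary.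
   Context: Extension: $\eta:\mathsf{F}^2\to\mathsf{F}$ is associative if $\eta_X\circ\mathsf{F}(\eta_X)=\eta_X\circ\eta_{\mathsf{F}(X)}$ for all $X$. The $\eta$-extension $\mathcal{B}\ltimes_\eta\mathsf{F}$ has as objects the pairs $(X,f)$ with $X\in\mathcal{B}$ and $f:\mathsf{F}(X)\to X$ such that $f\circ\mathsf{F}(f)=f\circ\eta_X$; a morphism $(X,f)\to(Y,g)$ is a morphism $\alpha:X\to Y$ in $\mathcal{B}$ with $\alpha\circ f=g\circ\mathsf{F}(\alpha)$. This is an abelian category with enough projectives, in which a sequence is exact if and only if the underlying sequence in $\mathcal{B}$ is exact. When $\eta=0$ one writes $\mathcal{B}\ltimes\mathsf{F}$ (right trivial extension). $\mathbb{L}_n\mathsf{F}$ denotes the $n$-th left derived functor of $\mathsf{F}$. For a class $\mathcal{S}$ of objects in an abelian category $\mathcal{A}$: ${}^{\perp}\mathcal{S}=\{Y : \mathrm{Ext}^1_{\mathcal{A}}(Y,S)=0\ \forall S\in\mathcal{S}\}$ and $\mathcal{S}^{\perp}=\{Y : \mathrm{Ext}^1_{\mathcal{A}}(S,Y)=0\ \forall S\in\mathcal{S}\}$. A pair $(\mathcal{C},\mathcal{D})$ of classes of objects is a cotorsion pair if $\mathcal{C}={}^{\perp}\mathcal{D}$ and $\mathcal{D}=\mathcal{C}^{\perp}$. It is called hereditary if it satisfies one of the following conditions, which are equivalent when $\mathcal{A}$ has enough projective objects and enough injective objects: (i) $\mathrm{Ext}^2_{\mathcal{A}}(C,D)=0$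 for all $C\in\mathcal{C}$, $D\in\mathcal{D}$; (ii) $\mathrm{Ext}^i_{\mathcal{A}}(C,D)=0$ for all $i\ge 1$, $C\in\mathcal{C}$, $D\in\mathcal{D}$; (iii) $\mathcal{C}$ is closed under kernels of epimorphisms; (iv) $\mathcal{D}$ is closed under cokernels of monomorphisms. For a class $\mathcal{X}$ of objects of $\mathcal{B}$: $\mathsf{U}^{-1}(\mathcal{X})=\{(X,f)\in\mathcal{B}\ltimes_\eta\mathsf{F} : X\in\mathcal{X}\}$, and $\Delta(\mathcal{X})$ is the class of objects $(X,f)$ such that the sequence $\mathsf{F}^2(X)\xrightarrow{\mathsf{F}(f)-\eta_X}\mathsf{F}(X)\xrightarrow{f}X$ is exact and $\mathrm{Coker}(f)\in\mathcal{X}$. When $\mathsf{F}^2=0$, $\Delta(\mathcal{X})$ consists of the $(X,f)$ with $f$ a monomorphism and $\mathrm{Coker}(f)\in\mathcal{X}$. *)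

(* Defs.v *)
From HB Require Import structures.
From mathcomp Require Import all_boot all_algebra.
From mathcomp Require Import boolp classical_sets.

Set Implicit Arguments.
Unset Strict Implicit.
Unset Printing Implicit Defensive.

Import GRing.Theory.
Local Open Scope ring_scope.
Local Open Scope classical_set_scope.

(** The choice operator carried by the [zmodType] of morphisms is harmless: in
    the presence of classical choice every type has one. *)

Record preadditive := Preadditive {
  ob :> Type;
  hom : ob -> ob -> zmodType;
  idm : forall X, hom X X;
  compose : forall X Y Z, hom Y Z -> hom X Y -> hom X Z;
  compA : forall X Y Z T (h : hom Z T) (g : hom Y Z) (f : hom X Y),
    compose h (compose g f) = compose (compose h g) f;
  comp1m : forall X Y (f : hom X Y), compose (idm Y) f = f;
  compm1 : forall X Y (f : hom X Y), compose f (idm X) = f;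
  compDl : forall X Y Z (g h : hom Y Z) (f : hom X Y),
    compose (g + h) f = compose g f + compose h f;
  compDr : forall X Y Z (g : hom Y Z) (f h : hom X Y),
    compose g (f + h) = compose g f + compose g h }.

Arguments hom {_} X Y.
Arguments idm {_} X.
Arguments compose {_ X Y Z} g f.

Reserved Notation "X ~> Y" (at level 90, right associativity).
Reserved Notation "g ∘ f" (at level 40, left associativity).
Notation "X ~> Y" := (hom X Y) : type_scope.
Notation "g ∘ f" := (compose g f) : ring_scope.

Section Basic.
Variable C : preadditive.
Implicit Types X Y Z : C.

Definition is_zero X : Prop :=
  (forall Y (f : X ~> Y), f = 0) /\ (forall Y (f : Y ~> X), f = 0).

Definition is_mono X Y (f : X ~> Y) : Prop :=
  forall Z (g h : Z ~> X), f ∘ g = f ∘ h -> g = h.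

Definition is_epi X Y (f : X ~> Y) : Prop :=
  forall Z (g h : Y ~> Z), g ∘ f = h ∘ f -> g = h.

Definition is_ker K X Y (k : K ~> X) (f : X ~> Y) : Prop :=
  f ∘ k = 0 /\
  forall Z (h : Z ~> X), f ∘ h = 0 -> exists! u : Z ~> K, k ∘ u = h.

Definition is_coker X Y Q (c : Y ~> Q) (f : X ~> Y) : Prop :=
  c ∘ f = 0 /\
  forall Z (h : Y ~> Z), h ∘ f = 0 -> exists! u : Q ~> Z, u ∘ c = h.

Definition is_biproduct X Y S
    (i1 : X ~> S) (i2 : Y ~> S) (p1 : S ~> X) (p2 : S ~> Y) : Prop :=
  [/\ p1 ∘ i1 = idm X, p2 ∘ i2 = idm Y, p1 ∘ i2 = 0, p2 ∘ i1 = 0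
    & i1 ∘ p1 + i2 ∘ p2 = idm S].

(** Exactness at the middle object: [f] maps epimorphically onto the kernel
    of [g]. *)
Definition exact X Y Z (f : X ~> Y) (g : Y ~> Z) : Prop :=
  exists K (k : K ~> Y) (e : X ~> K), [/\ is_ker k g, f = k ∘ e & is_epi e].

Definition is_projective P : Prop :=
  forall X Y (e : X ~> Y), is_epi e ->
  forall f : P ~> Y, exists g : P ~> X, e ∘ g = f.

Definition is_injective I : Prop :=
  forall X Y (m : X ~> Y), is_mono m ->
  forall f : X ~> I, exists g : Y ~> I, g ∘ m = f.

Definition enough_projectives : Prop :=
  forall X, exists P (e : P ~> X), is_projective P /\ is_epi e.

Definition enough_injectives : Prop :=
  forall X, exists I (m : X ~> I), is_injective I /\ is_mono m.

Record is_abelian : Prop := IsAbelian {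
  ab_zero : exists Z, is_zero Z;
  ab_biproduct : forall X Y, exists S
    (i1 : X ~> S) (i2 : Y ~> S) (p1 : S ~> X) (p2 : S ~> Y),
    is_biproduct i1 i2 p1 p2;
  ab_ker : forall X Y (f : X ~> Y), exists K (k : K ~> X), is_ker k f;
  ab_coker : forall X Y (f : X ~> Y), exists Q (c : Y ~> Q), is_coker c f;
  ab_mono : forall X Y (f : X ~> Y), is_mono f ->
    exists Z (g : Y ~> Z), is_ker f g;
  ab_epi : forall X Y (f : X ~> Y), is_epi f ->
    exists Z (g : Z ~> X), is_coker f g }.

End Basic.

Arguments enough_projectives : clear implicits.
Arguments enough_injectives : clear implicits.
Arguments is_abelian : clear implicits.

Record abelian := Abelian {
  ab_cat :> preadditive;
  ab_ax : is_abelian ab_cat }.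

Record additive_functor (A B : preadditive) := AdditiveFunctor {
  fob :> A -> B;
  fmap : forall X Y, (X ~> Y) -> (fob X ~> fob Y);
  fmap1 : forall X, fmap (idm X) = idm (fob X);
  fmapM : forall X Y Z (g : Y ~> Z) (f : X ~> Y),
    fmap (g ∘ f) = fmap g ∘ fmap f;
  fmapD : forall X Y (f g : X ~> Y), fmap (f + g) = fmap f + fmap g }.

Arguments fmap {A B} F {X Y} f : rename.

Section FunctorComposition.
Variables (A B C : preadditive).
Variables (G : additive_functor B C) (F : additive_functor A B).

Fact compF1 X : fmap G (fmap F (idm X)) = idm (G (F X)).
Proof. by rewrite !fmap1. Qed.

Fact compFM X Y Z (g : Y ~> Z) (f : X ~> Y) :
  fmap G (fmap F (g ∘ f)) = fmap G (fmap F g) ∘ fmap G (fmap F f).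
Proof. by rewrite !fmapM. Qed.

Fact compFD X Y (f g : X ~> Y) :
  fmap G (fmap F (f + g)) = fmap G (fmap F f) + fmap G (fmap F g).
Proof. by rewrite !fmapD. Qed.

Definition compF : additive_functor A C :=
  @AdditiveFunctor A C (fun X => G (F X)) (fun _ _ f => fmap G (fmap F f))
    compF1 compFM compFD.
End FunctorComposition.

Record nat_trans (A B : preadditive) (F G : additive_functor A B) := NatTrans {
  nt_app :> forall X, F X ~> G X;
  nt_natural : forall X Y (f : X ~> Y),
    nt_app Y ∘ fmap F f = fmap G f ∘ nt_app X }.

Definition right_exact (A B : preadditive) (F : additive_functor A B) : Prop :=
  forall (X Y Z : A) (f : X ~> Y) (g : Y ~> Z),
    exact f g -> is_epi g -> exact (fmap F f) (fmap F g) /\ is_epi (fmap F g).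

Definition assoc_nt (A : preadditive) (F : additive_functor A A)
    (eta : nat_trans (compF F F) F) : Prop :=
  forall X : A, eta X ∘ fmap F (eta X) = eta X ∘ eta (F X).

Section PreadditiveTheory.
Variable C : preadditive.
Implicit Types X Y Z : C.

Lemma comp0m X Y Z (f : X ~> Y) : (0 : Y ~> Z) ∘ f = 0.
Proof. by apply: (addrI (0 ∘ f)); rewrite -compDl !addr0. Qed.

Lemma compm0 X Y Z (f : Y ~> Z) : f ∘ (0 : X ~> Y) = 0.
Proof. by apply: (addrI (f ∘ 0)); rewrite -compDr !addr0. Qed.

Lemma compNm X Y Z (g : Y ~> Z) (f : X ~> Y) : (- g) ∘ f = - (g ∘ f).
Proof. by apply: (addrI (g ∘ f)); rewrite -compDl !subrr comp0m. Qed.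

Lemma compmN X Y Z (g : Y ~> Z) (f : X ~> Y) : g ∘ (- f) = - (g ∘ f).
Proof. by apply: (addrI (g ∘ f)); rewrite -compDr !subrr compm0. Qed.

Lemma is_monoP X Y (f : X ~> Y) :
  is_mono f <-> forall Z (g : Z ~> X), f ∘ g = 0 -> g = 0.
Proof.
split=> [fm Z g fg0|fm Z g h fgh]; first by apply: fm; rewrite fg0 compm0.
by apply/subr0_eq/fm; rewrite compDr compmN fgh subrr.
Qed.

Lemma is_epiP X Y (f : X ~> Y) :
  is_epi f <-> forall Z (g : Y ~> Z), g ∘ f = 0 -> g = 0.
Proof.
split=> [fm Z g fg0|fm Z g h fgh]; first by apply: fm; rewrite fg0 comp0m.
by apply/subr0_eq/fm; rewrite compDl compNm fgh subrr.
Qed.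

Lemma ker_mono K X Y (k : K ~> X) (f : X ~> Y) : is_ker k f -> is_mono k.
Proof.
move=> [fk0 kU] Z g h kgh.
have [|u [_ uU]] := kU _ (k ∘ g); first by rewrite compA fk0 comp0m.
by rewrite -(uU g) // -(uU h).
Qed.

Lemma coker_epi X Y Q (c : Y ~> Q) (f : X ~> Y) : is_coker c f -> is_epi c.
Proof.
move=> [cf0 cU] Z g h gch.
have [|u [_ uU]] := cU _ (g ∘ c); first by rewrite -compA cf0 compm0.
by rewrite -(uU g) // -(uU h).
Qed.

Lemma is_kerI K X Y (k : K ~> X) (f : X ~> Y) : is_mono k -> f ∘ k = 0 ->
  (forall Z (h : Z ~> X), f ∘ h = 0 -> exists u : Z ~> K, k ∘ u = h) ->
  is_ker k f.
Proof.
move=> km fk0 kU; split=> // Z h /kU[u ku]; exists u; split=> // v kv.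
by apply: km; rewrite ku.
Qed.

Lemma is_cokerI X Y Q (c : Y ~> Q) (f : X ~> Y) : is_epi c -> c ∘ f = 0 ->
  (forall Z (h : Y ~> Z), h ∘ f = 0 -> exists u : Q ~> Z, u ∘ c = h) ->
  is_coker c f.
Proof.
move=> ce cf0 cU; split=> // Z h /cU[u uc]; exists u; split=> // v vc.
by apply: ce; rewrite uc.
Qed.

End PreadditiveTheory.

Lemma fmap0 (A B : preadditive) (F : additive_functor A B) (X Y : A) :
  fmap F (0 : X ~> Y) = 0.
Proof. by apply: (addrI (fmap F 0)); rewrite -fmapD !addr0. Qed.

Section AbelianTheory.
Variable C : preadditive.
Hypothesis abC : is_abelian C.
Implicit Types X Y Z : C.

Lemma mono_ker_coker X Y Q (m : X ~> Y) (c : Y ~> Q) :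
  is_mono m -> is_coker c m -> is_ker m c.
Proof.
move=> mm [cm0 cU]; have [Z [g [gm0 gU]]] := ab_mono abC mm.
apply: is_kerI => // T h ch0; have [g' [g'c _]] := cU _ _ gm0.
have [|u [mu _]] := gU _ h; first by rewrite -g'c -compA ch0 compm0.
by exists u.
Qed.

Lemma epi_coker_ker K X Y (k : K ~> X) (e : X ~> Y) :
  is_epi e -> is_ker k e -> is_coker e k.
Proof.
move=> ee [ek0 kU]; have [Z [g [eg0 gU]]] := ab_epi abC ee.
apply: is_cokerI => // T h hk0; have [g' [kg' _]] := kU _ _ eg0.
have [|u [mu _]] := gU _ h; first by rewrite -kg' compA hk0 comp0m.
by exists u.
Qed.

Lemma coker_exact X Y Q (f : X ~> Y) (c : Y ~> Q) :
  is_coker c f -> exact f c.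
Proof.
move=> cP; have [cf0 cU] := cP.
have [K [k kP]] := ab_ker abC c; have [ck0 kU] := kP.
have [e [ke _]] := kU _ _ cf0; exists K, k, e; split=> //.
apply/is_epiP => Z h he0.
have [J [j jP]] := ab_ker abC h; have [hj0 jU] := jP.
have [e' [je' _]] := jU _ _ he0.
have kjm : is_mono (k ∘ j).
  move=> T u v; rewrite -!compA => kjuv.
  exact/(ker_mono jP)/(ker_mono kP).
have [R [q qP]] := ab_coker abC (k ∘ j).
have [_ kjU] := mono_ker_coker kjm qP; have [qkj0 _] := qP.
have [|q' [q'c _]] := cU _ q.
  by rewrite -ke -je' !compA -(compA q) qkj0 comp0m.
have [|t [kjt _]] := kjU _ k; first by rewrite -q'c -compA ck0 compm0.
have jt : j ∘ t = idm K by apply: (ker_mono kP); rewrite compA kjt compm1.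
by rewrite -(compm1 h) -jt compA hj0 comp0m.
Qed.

Lemma exact_coker X Y Z (f : X ~> Y) (g : Y ~> Z) :
  exact f g -> is_epi g -> is_coker g f.
Proof.
move=> [K [k [e [kP fE ee]]]] ge; have [gk0 gU] := epi_coker_ker ge kP.
apply: is_cokerI => // [|T h]; rewrite fE compA; first by rewrite gk0 comp0m.
move/is_epiP: ee => ee /ee /gU[u [ug _]]; by exists u.
Qed.

End AbelianTheory.

Lemma right_exact_coker (A B : abelian) (F : additive_functor A B)
    (X Y Q : A) (f : X ~> Y) (c : Y ~> Q) :
  right_exact F -> is_coker c f -> is_coker (fmap F c) (fmap F f).
Proof.
move=> Fr cP; have ce := coker_epi cP.
have [Fex Fe] := Fr _ _ _ _ _ (coker_exact (ab_ax A) cP) ce.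
exact: exact_coker (ab_ax B) _ _ _ _ _ Fex Fe.
Qed.

Section Extension.
Variables (B : preadditive) (F : additive_functor B B).
Variable eta : nat_trans (compF F F) F.

Record ext_ob := ExtOb {
  carrier : B;
  str : F carrier ~> carrier;
  strP : str ∘ fmap F str = str ∘ eta carrier }.

Definition ext_hom_pred (X Y : ext_ob) :=
  [pred a : carrier X ~> carrier Y | a ∘ str X == str Y ∘ fmap F a].

Record ext_hom (X Y : ext_ob) := ExtHom {
  mor :> carrier X ~> carrier Y;
  morP : ext_hom_pred X Y mor }.

HB.instance Definition _ X Y := [isSub for @mor X Y].
HB.instance Definition _ X Y := [Choice of ext_hom X Y by <:].

Fact ext_hom_zmod_closed X Y : zmod_closed (ext_hom_pred X Y).
Proof.
split=> [|a b]; rewrite !inE; first by rewrite fmap0 comp0m compm0.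
move=> /eqP aP /eqP bP; rewrite compDl compNm aP bP fmapD compDr -compmN.
have -> // : fmap F (- b) = - fmap F b.
by apply: (addrI (fmap F b)); rewrite -fmapD !subrr fmap0.
Qed.

HB.instance Definition _ X Y :=
  GRing.SubChoice_isSubZmodule.Build _ _ (ext_hom X Y)
    (@ext_hom_zmod_closed X Y).

Lemma ext_homE X Y (a : ext_hom X Y) : a ∘ str X = str Y ∘ fmap F a.
Proof. exact/eqP/morP. Qed.

Fact ext_id_subproof X : ext_hom_pred X X (idm (carrier X)).
Proof. by rewrite /= fmap1 comp1m compm1. Qed.

Definition ext_id X : ext_hom X X := ExtHom (ext_id_subproof X).

Fact ext_comp_subproof X Y Z (b : ext_hom Y Z) (a : ext_hom X Y) :
  ext_hom_pred X Z (mor b ∘ mor a).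
Proof. by rewrite /= -compA ext_homE compA ext_homE fmapM compA. Qed.

Definition ext_comp X Y Z (b : ext_hom Y Z) (a : ext_hom X Y) : ext_hom X Z :=
  ExtHom (ext_comp_subproof b a).

Fact ext_compA X Y Z T (h : ext_hom Z T) (g : ext_hom Y Z) (f : ext_hom X Y) :
  ext_comp h (ext_comp g f) = ext_comp (ext_comp h g) f.
Proof. by apply: val_inj; apply: compA. Qed.

Fact ext_comp1m X Y (f : ext_hom X Y) : ext_comp (ext_id Y) f = f.
Proof. by apply: val_inj; apply: comp1m. Qed.

Fact ext_compm1 X Y (f : ext_hom X Y) : ext_comp f (ext_id X) = f.
Proof. by apply: val_inj; apply: compm1. Qed.

Fact ext_compDl X Y Z (g h : ext_hom Y Z) (f : ext_hom X Y) :
  ext_comp (g + h) f = ext_comp g f + ext_comp h f.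
Proof. by apply: val_inj; apply: compDl. Qed.

Fact ext_compDr X Y Z (g : ext_hom Y Z) (f h : ext_hom X Y) :
  ext_comp g (f + h) = ext_comp g f + ext_comp g h.
Proof. by apply: val_inj; apply: compDr. Qed.

Definition ext_cat : preadditive :=
  @Preadditive ext_ob (fun X Y => ext_hom X Y : zmodType) ext_id ext_comp
    ext_compA ext_comp1m ext_compm1 ext_compDl ext_compDr.

End Extension.

Section ExtensionTheory.
Variables (B : abelian) (F : additive_functor B B).
Variable eta : nat_trans (compF F F) F.
Hypothesis Frex : right_exact F.

Local Notation E := (ext_cat eta).
Let abB := ab_ax B.

Lemma ext_mono (X Y : E) (a : X ~> Y) : is_mono (mor a) -> is_mono a.
Proof.
by move=> am Z g h /(congr1 (@mor _ _ _ _ _)) /am gh; apply: val_inj.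
Qed.

Lemma ext_epi (X Y : E) (a : X ~> Y) : is_epi (mor a) -> is_epi a.
Proof.
by move=> ae Z g h /(congr1 (@mor _ _ _ _ _)) /ae gh; apply: val_inj.
Qed.

Lemma ext_is_ker (K X Y : E) (k : K ~> X) (a : X ~> Y) :
  is_ker (mor k) (mor a) -> is_ker k a.
Proof.
move=> kP; have [ak0 kU] := kP; have km := ker_mono kP.
apply: is_kerI => [||Z h]; [exact: ext_mono|exact: val_inj|].
move=> /(congr1 (@mor _ _ _ _ _)) /kU[u [ku _]].
have uP : ext_hom_pred Z K u.
  apply/eqP/km; rewrite !compA ku (ext_homE h) (ext_homE k) -compA.
  by rewrite -fmapM ku.
by exists (ExtHom uP); apply: val_inj.
Qed.

Lemma ext_is_coker (X Y Q : E) (c : Y ~> Q) (a : X ~> Y) :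
  is_coker (mor c) (mor a) -> is_coker c a.
Proof.
move=> cP; have [ca0 cU] := cP; have ce := coker_epi cP.
have Fce : is_epi (fmap F (mor c)).
  exact: coker_epi (right_exact_coker Frex cP).
apply: is_cokerI => [||Z h]; [exact: ext_epi|exact: val_inj|].
move=> /(congr1 (@mor _ _ _ _ _)) /cU[u [uc _]].
have uP : ext_hom_pred Q Z u.
  apply/eqP/Fce; rewrite -!compA -(ext_homE c) compA uc (ext_homE h).
  by rewrite -fmapM uc.
by exists (ExtHom uP); apply: val_inj.
Qed.

Lemma ext_ker_lift (X Y : E) (a : X ~> Y) :
  exists (K : E) (k : K ~> X), is_ker (mor k) (mor a).
Proof.
have [K [k kP]] := ab_ker abB (mor a); have [ak0 kU] := kP.
have [|f [kf _]] := kU _ (str X ∘ fmap F k).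
  by rewrite compA (ext_homE a) -compA -fmapM ak0 fmap0 compm0.
have fP : f ∘ fmap F f = f ∘ eta K.
  apply: (ker_mono kP); rewrite !compA kf -!compA -fmapM kf fmapM compA strP.
  by rewrite -!compA (nt_natural eta k).
have kE : ext_hom_pred (ExtOb fP) X k by apply/eqP.
by exists (ExtOb fP), (ExtHom kE).
Qed.

Lemma ext_coker_lift (X Y : E) (a : X ~> Y) :
  exists (Q : E) (c : Y ~> Q), is_coker (mor c) (mor a).
Proof.
have [Q [c cP]] := ab_coker abB (mor a); have [ca0 _] := cP.
have FcP := right_exact_coker Frex cP; have [_ FcU] := FcP.
have FFcP := right_exact_coker Frex FcP.
have [|f [fc _]] := FcU _ (c ∘ str Y).
  by rewrite -compA -(ext_homE a) compA ca0 comp0m.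
have fP : f ∘ fmap F f = f ∘ eta Q.
  apply: (coker_epi FFcP); rewrite -!compA -fmapM fc fmapM compA fc -compA strP.
  by rewrite (nt_natural eta c) !compA fc.
have cE : ext_hom_pred Y (ExtOb fP) c by apply/eqP.
by exists (ExtOb fP), (ExtHom cE).
Qed.

Lemma ext_monoP (X Y : E) (a : X ~> Y) : is_mono a <-> is_mono (mor a).
Proof.
split=> [am|]; last exact: ext_mono.
have [K [k [ak0 kU]]] := ext_ker_lift a.
have k0 : k = 0 by move/is_monoP: am; apply; apply: val_inj.
apply/is_monoP => Z g /kU[u [<- _]]; by rewrite k0 comp0m.
Qed.

Lemma ext_epiP (X Y : E) (a : X ~> Y) : is_epi a <-> is_epi (mor a).
Proof.
split=> [ae|]; last exact: ext_epi.
have [Q [c [ca0 cU]]] := ext_coker_lift a.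
have c0 : c = 0 by move/is_epiP: ae; apply; apply: val_inj.
apply/is_epiP => Z g /cU[u [<- _]]; by rewrite c0 compm0.
Qed.

Lemma ext_biproduct (X Y : E) : exists (S : E)
  (i1 : X ~> S) (i2 : Y ~> S) (p1 : S ~> X) (p2 : S ~> Y),
  is_biproduct i1 i2 p1 p2.
Proof.
have [S [i1 [i2 [p1 [p2 [pi11 pi22 pi12 pi21 ip]]]]]] :=
  ab_biproduct abB (carrier X) (carrier Y).
pose f := i1 ∘ str X ∘ fmap F p1 + i2 ∘ str Y ∘ fmap F p2.
have p1f : p1 ∘ f = str X ∘ fmap F p1.
  by rewrite compDr !compA pi11 pi12 !comp1m !comp0m addr0.
have p2f : p2 ∘ f = str Y ∘ fmap F p2.
  by rewrite compDr !compA pi21 pi22 !comp1m !comp0m add0r.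
have fi1 : f ∘ fmap F i1 = i1 ∘ str X.
  rewrite compDl -!compA -!fmapM pi11 pi21 fmap1 fmap0 compm1 !compm0.
  by rewrite addr0.
have fi2 : f ∘ fmap F i2 = i2 ∘ str Y.
  rewrite compDl -!compA -!fmapM pi12 pi22 fmap1 fmap0 compm1 !compm0.
  by rewrite add0r.
have fP : f ∘ fmap F f = f ∘ eta S.
  rewrite {1}/f {2}/f compDl !compDl -!compA -!fmapM p1f p2f !fmapM.
  by rewrite !(compA (str _)) !strP -!compA !(nt_natural eta).
pose T : E := ExtOb fP.
have i1P : ext_hom_pred X T i1 by apply/eqP.
have i2P : ext_hom_pred Y T i2 by apply/eqP.
have p1P : ext_hom_pred T X p1 by apply/eqP.
have p2P : ext_hom_pred T Y p2 by apply/eqP.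
exists T, (ExtHom i1P), (ExtHom i2P), (ExtHom p1P), (ExtHom p2P).
by split; apply: val_inj.
Qed.

Theorem ext_is_abelian : is_abelian E.
Proof.
split=> [|X Y|X Y f|X Y f|X Y f fm|X Y f fe].
- have [Z [Z0 Z1]] := ab_zero abB.
  have fP : (0 : F Z ~> Z) ∘ fmap F 0 = 0 ∘ eta Z by rewrite !comp0m.
  exists (ExtOb fP); split=> Y f; apply: val_inj; [exact: Z0|exact: Z1].
- exact: ext_biproduct.
- by have [K [k kP]] := ext_ker_lift f; exists K, k; apply: ext_is_ker.
- by have [Q [c cP]] := ext_coker_lift f; exists Q, c; apply: ext_is_coker.
- have [Q [c cP]] := ext_coker_lift f; exists Q, c; apply: ext_is_ker.
  by apply: mono_ker_coker cP => //; apply/ext_monoP.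
- have [K [k kP]] := ext_ker_lift f; exists K, k; apply: ext_is_coker.
  by apply: epi_coker_ker kP => //; apply/ext_epiP.
Qed.

Theorem ext_enough_projectives :
  assoc_nt eta -> enough_projectives B -> enough_projectives E.
Proof.
move=> eta_assoc enB X.
have [P [a [Pproj ae]]] := enB (carrier X).
have [S [i1 [i2 [p1 [p2 [pi11 pi22 pi12 pi21 ip]]]]]] :=
  ab_biproduct abB P (F P).
pose m : F S ~> F P := fmap F p1 + eta P ∘ fmap F p2.
pose t := i2 ∘ m.
have mt : m ∘ fmap F t = m ∘ eta S.
  rewrite {1}/m compDl -compA -!fmapM /t !compA pi12 pi22 comp1m comp0m fmap0.
  rewrite add0r fmapD fmapM compDl !compDr !compA eta_assoc -!compA.
  by rewrite !(nt_natural eta).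
have tP : t ∘ fmap F t = t ∘ eta S by rewrite -!compA mt.
pose T : E := ExtOb tP.
have ti1 : t ∘ fmap F i1 = i2.
  rewrite -compA compDl -compA -!fmapM pi11 pi21 fmap1 fmap0 compm0 addr0.
  by rewrite compm1.
pose free (Y : E) (b : P ~> carrier Y) : S ~> carrier Y :=
  b ∘ p1 + str Y ∘ fmap F b ∘ p2.
have freeP (Y : E) (b : P ~> carrier Y) : ext_hom_pred T Y (free Y b).
  apply/eqP; rewrite compDl -!compA !(compA _ i2) pi12 pi22 comp0m compm0 add0r.
  rewrite comp1m !fmapD !fmapM !compDr; congr (_ + _).
  by rewrite !(compA (str Y)) strP -!compA (compA (eta _)) (nt_natural eta) !compA.
exists T, (ExtHom (freeP X a)); split.
  move=> Y Z e /ext_epiP ee h.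
  have [b eb] := Pproj _ _ _ ee (mor h ∘ i1).
  exists (ExtHom (freeP Y b)); apply: val_inj; rewrite /= /free.
  rewrite compDr !compA eb ext_homE -!(compA (str Z)) -fmapM eb fmapM !compA.
  rewrite -(ext_homE h) /= -(compA (mor h) t) ti1.
  by rewrite -!compA -compDr ip compm1.
apply: ext_epi => Z g h gh; apply: ae.
have <- : free X a ∘ i1 = a.
  by rewrite /free compDl -!compA pi11 pi21 !compm0 compm1 addr0.
by rewrite !compA; congr (_ ∘ _).
Qed.

End ExtensionTheory.

Section Homological.
Variable A : abelian.
Implicit Types X Y S : A.

Record projective_resolution X := ProjectiveResolution {
  res_ob :> nat -> A;
  res_d : forall n, res_ob n.+1 ~> res_ob n;
  res_aug : res_ob 0 ~> X;
  res_proj : forall n, is_projective (res_ob n);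
  res_exact : forall n, exact (res_d n.+1) (res_d n);
  res_exact0 : exact (res_d 0) res_aug;
  res_epi : is_epi res_aug }.

(** [H] is the homology of [X --f--> Y --g--> Z] at [Y], that is, the cokernel
    of the morphism from [X] to the kernel of [g] induced by [f]. *)
Definition is_homology X Y Z (f : X ~> Y) (g : Y ~> Z) (H : A) : Prop :=
  exists K (k : K ~> Y) (f' : X ~> K) (c : K ~> H),
    [/\ is_ker k g, f = k ∘ f' & is_coker c f'].

(** Vanishing of Ext^n(X, S), the cohomology in degree n of the complex
    Hom(P, S) for a projective resolution P of X: every cocycle is a
    coboundary. As for any derived functor the choice of P is immaterial, and
    P exists when there are enough projectives. *)
Definition Ext_eq0 (n : nat) X S : Prop :=
  forall P : projective_resolution X,
  match n with
  | 0 => forall phi : P 0%N ~> S, phi ∘ res_d P 0 = 0 -> phi = 0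
  | m.+1 => forall phi : P m.+1 ~> S, phi ∘ res_d P m.+1 = 0 ->
              exists psi : P m ~> S, phi = psi ∘ res_d P m
  end.

Definition perp_l (S : set A) : set A :=
  [set Y | forall X, S X -> Ext_eq0 1 Y X].

Definition perp_r (S : set A) : set A :=
  [set Y | forall X, S X -> Ext_eq0 1 X Y].

Definition cotorsion_pair (C D : set A) : Prop :=
  C = perp_l D /\ D = perp_r C.

Definition closed_ker_epi (C : set A) : Prop :=
  forall (K X Y : A) (k : K ~> X) (e : X ~> Y),
    is_epi e -> is_ker k e -> C X -> C Y -> C K.

Definition closed_coker_mono (D : set A) : Prop :=
  forall (X Y Q : A) (m : X ~> Y) (c : Y ~> Q),
    is_mono m -> is_coker c m -> D X -> D Y -> D Q.

(** The four conditions are equivalent when there are enough projectives and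
    enough injectives; in general a pair is hereditary as soon as it satisfies
    one of them. *)
Definition hereditary (C D : set A) : Prop :=
  [\/ forall X Y, C X -> D Y -> Ext_eq0 2 X Y,
      forall i X Y, (1 <= i)%N -> C X -> D Y -> Ext_eq0 i X Y,
      closed_ker_epi C
    | closed_coker_mono D].

End Homological.

(** [L] is the value at [X], which is defined up to isomorphism, of the n-th
    left derived functor of [F]. *)
Definition is_left_derived (A B : abelian) (F : additive_functor A B) (n : nat)
    (X : A) (L : B) : Prop :=
  exists P : projective_resolution X,
  match n with
  | 0 => exists c : F (P 0%N) ~> L, is_coker c (fmap F (res_d P 0))
  | m.+1 => is_homology (fmap F (res_d P m.+1)) (fmap F (res_d P m)) L
  end.

Definition left_derived_eq0 (A B : abelian) (F : additive_functor A B) (n : nat)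
    (X : A) : Prop :=
  forall L : B, is_left_derived F n X L -> is_zero L.

Section EtaExtension.
Variables (B : abelian) (F : additive_functor B B).
Variable eta : nat_trans (compF F F) F.
Hypothesis Frex : right_exact F.

Definition extension : abelian := Abelian (ext_is_abelian eta Frex).

Definition forget (X : extension) : B := carrier X.

(** [exists Q c] expresses that the cokernel of the structure morphism lies in
    [X], for classes [X] closed under isomorphisms. *)
Definition Delta (X : set B) : set extension :=
  [set M | exact (fmap F (str M) - eta (carrier M)) (str M) /\
    exists Q (c : carrier M ~> Q), is_coker c (str M) /\ X Q].

End EtaExtension.

Arguments forget {B F} eta Frex X.
Arguments Delta {B F} eta Frex X.

(* Main.v *)
(** Chases are done on generalized elements with projective source, which lift
    along epimorphisms. [Ext^1(X, S) = 0] is tested on one presentation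
    [0 -> K -> P -> X -> 0]: every [K -> S] must extend to [P].

    The free object [T X = X + F X] is left adjoint to the forgetful functor,
    and [L_1 F (X) = 0] makes [T] exact on a presentation of [X], whence
    [Ext^1(T X, M) = Ext^1(X, U M)]; this gives the cotorsion pair of (1).
    For (2), the cokernel functor is left adjoint to [Y |-> (Y, 0)], and
    [Ext^1(M, (Y, 0)) = Ext^1(Coker f, Y)] for [M = (X, f)] with [f] mono, while
    [Ext^1(M, (I, 0)) = 0] for all injective [I] forces [f] to be mono. Hence
    [Delta(X)] is the left orthogonal of the objects [(Y, 0)] with [Y] in the
    right-hand class.

    The extension need not have enough injectives, so the four conditions for
    a hereditary pair are not known to be equivalent there. Each of them implies
    that the right-hand class is closed under cokernels of monomorphisms, and
    this descends to [B] along [Y |-> (Y, 0)]. In the other direction one lifts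
    this condition for (1), but closure of the left-hand class under kernels
    of epimorphisms for (2). *)

From mathcomp Require Import all_boot all_algebra.
From mathcomp Require Import boolp classical_sets.
Require Import Defs.

Set Implicit Arguments.
Unset Strict Implicit.
Unset Printing Implicit Defensive.

Import GRing.Theory.
Local Open Scope ring_scope.
Local Open Scope classical_set_scope.

(** * Factorizations through kernels and cokernels in a preadditive category *)

Section Preadditive.
Variable C : preadditive.
Implicit Types X Y Z : C.

Lemma compAl X Y Z (f : X ~> Y) (g : Y ~> Z) (h : X ~> Z) :
  g ∘ f = h -> forall T (x : T ~> X), g ∘ (f ∘ x) = h ∘ x.
Proof. by move=> <- T x; rewrite compA. Qed.

Lemma compBr X Y Z (g : Y ~> Z) (f h : X ~> Y) :
  g ∘ (f - h) = g ∘ f - g ∘ h.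
Proof. by rewrite compDr compmN. Qed.

Lemma compBl X Y Z (g h : Y ~> Z) (f : X ~> Y) :
  (g - h) ∘ f = g ∘ f - h ∘ f.
Proof. by rewrite compDl compNm. Qed.

Lemma ker_lift K X Y Z (k : K ~> X) (f : X ~> Y) (h : Z ~> X) :
  is_ker k f -> f ∘ h = 0 -> exists u, k ∘ u = h.
Proof. by move=> [_ kU] /kU[u [ku _]]; exists u. Qed.

Lemma coker_desc X Y Q Z (c : Y ~> Q) (f : X ~> Y) (h : Y ~> Z) :
  is_coker c f -> h ∘ f = 0 -> exists u, u ∘ c = h.
Proof. by move=> [_ cU] /cU[u [uc _]]; exists u. Qed.

Lemma mono_eq0 X Y Z (m : X ~> Y) (x : Z ~> X) : is_mono m -> m ∘ x = 0 -> x = 0.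
Proof. by move=> /is_monoP; apply. Qed.

Lemma epi_eq0 X Y Z (e : X ~> Y) (h : Y ~> Z) : is_epi e -> h ∘ e = 0 -> h = 0.
Proof. by move=> /is_epiP; apply. Qed.

Lemma is_epi_comp X Y Z (g : Y ~> Z) (f : X ~> Y) :
  is_epi g -> is_epi f -> is_epi (g ∘ f).
Proof. by move=> ge fe T u v; rewrite !compA => /fe/ge. Qed.

Lemma is_mono_comp X Y Z (g : Y ~> Z) (f : X ~> Y) :
  is_mono g -> is_mono f -> is_mono (g ∘ f).
Proof. by move=> ge fe T u v; rewrite -!compA => /ge/fe. Qed.

Lemma biproduct_split X Y S (i1 : X ~> S) (i2 : Y ~> S) p1 p2 Z (x : Z ~> S) :
  is_biproduct i1 i2 p1 p2 -> x = i1 ∘ (p1 ∘ x) + i2 ∘ (p2 ∘ x).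
Proof. by case=> _ _ _ _ ip; rewrite !compA -compDl ip comp1m. Qed.

End Preadditive.

Section FunctorLemmas.
Variables (A B : preadditive) (F : additive_functor A B).

Lemma fmapN (X Y : A) (f : X ~> Y) : fmap F (- f) = - fmap F f.
Proof. by apply: (addrI (fmap F f)); rewrite -fmapD !subrr fmap0. Qed.

End FunctorLemmas.

(** * Diagram chases on elements with projective source *)

Section Chase.
Variable A : abelian.
Hypothesis enough : enough_projectives A.
Implicit Types X Y Z S : A.
Let abA := ab_ax A.

Lemma mono_on_projectives X Y (f : X ~> Y) :
  (forall P (x : P ~> X), is_projective P -> f ∘ x = 0 -> x = 0) -> is_mono f.
Proof.
move=> fP; apply/is_monoP => Z g fg0; have [P [p [Pp pe]]] := enough Z.
by apply: (epi_eq0 pe); apply: fP => //; rewrite compA fg0 comp0m.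
Qed.

Lemma epi_on_projectives X Y (f : X ~> Y) :
  (forall P (y : P ~> Y), is_projective P -> exists x, f ∘ x = y) -> is_epi f.
Proof.
move=> fP; have [P [p [Pp pe]]] := enough Y; have [x fx] := fP _ p Pp.
apply/is_epiP => Z g gf0; apply: (epi_eq0 pe).
by rewrite -fx compA gf0 comp0m.
Qed.

Lemma exact_on_projective X Y Q P (f : X ~> Y) (c : Y ~> Q) (x : P ~> Y) :
  is_projective P -> is_coker c f -> c ∘ x = 0 -> exists y, f ∘ y = x.
Proof.
move=> Pp /(coker_exact abA)[K [k [e [kP -> ee]]]] /(ker_lift kP)[u <-].
by have [y <-] := Pp _ _ _ ee u; exists y; rewrite compA.
Qed.

(** An epimorphism is the cokernel of its kernel, and a map killing [f] kills that kernel, since a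
    projective mapping onto the kernel factors through [f]. *)
Lemma coker_on_projectives X Y Q (f : X ~> Y) (c : Y ~> Q) :
  is_epi c -> c ∘ f = 0 ->
  (forall P (x : P ~> Y), is_projective P -> c ∘ x = 0 ->
     exists y, f ∘ y = x) -> is_coker c f.
Proof.
move=> ce cf0 cP; apply: is_cokerI => // Z h hf0.
have [K [k kP]] := ab_ker abA c; have ckP := epi_coker_ker abA ce kP.
apply: (coker_desc ckP); have [P [p [Pp pe]]] := enough K.
apply: (epi_eq0 pe); have [|y fy] := cP _ (k ∘ p) Pp.
  by rewrite compA kP.1 comp0m.
by rewrite -compA -fy compA hf0 comp0m.
Qed.

Lemma epi_factor X Y Z (e : X ~> Y) (h : X ~> Z) : is_epi e ->
  (forall T (x : T ~> X), e ∘ x = 0 -> h ∘ x = 0) -> exists u, u ∘ e = h.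
Proof.
move=> ee eh; have [K [k kP]] := ab_ker abA e.
apply: (coker_desc (epi_coker_ker abA ee kP)).
by apply: eh; exact: kP.1.
Qed.

(** * Presentations, projective resolutions and Ext^1 *)

Definition presentation K P X (k : K ~> P) (e : P ~> X) : Prop :=
  [/\ is_projective P, is_epi e & is_ker k e].

Lemma presentation_exists X : exists K P (k : K ~> P) (e : P ~> X),
  presentation k e.
Proof.
have [P [e [Pp ee]]] := enough X; have [K [k kP]] := ab_ker abA e.
by exists K, P, k, e.
Qed.

Lemma cons_resolution_exact K P X (k : K ~> P) (e : P ~> X)
    (R : projective_resolution K) :
  presentation k e -> exact (k ∘ res_aug R) e.
Proof. by move=> [_ _ kP]; exists K, k, (res_aug R); split=> //; apply: res_epi. Qed.

Lemma exact_comp_mono X Y Z T (f : X ~> Y) (g : Y ~> Z) (m : Z ~> T) :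
  is_mono m -> exact f g -> exact f (m ∘ g).
Proof.
move=> mm [K [k [e [kP fE ee]]]]; exists K, k, e; split=> //.
have [gk0 _] := kP; apply: is_kerI; first exact: ker_mono kP.
  by rewrite -compA gk0 compm0.
by move=> U h; rewrite -compA => /(mono_eq0 mm)/(ker_lift kP).
Qed.

Lemma exact_comp_monoK X Y Z T (f : X ~> Y) (g : Y ~> Z) (m : Z ~> T) :
  is_mono m -> exact f (m ∘ g) -> exact f g.
Proof.
move=> mm [K [k [e [kP fE ee]]]]; exists K, k, e; split=> //.
apply: is_kerI; first exact: ker_mono kP.
  by apply: (mono_eq0 mm); rewrite compA kP.1.
by move=> U h gh0; apply: (ker_lift kP); rewrite -compA gh0 compm0.
Qed.

(** Kept transparent: this is [R] shifted by one degree, and later arguments read off its terms and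
    differentials by computation. *)
Definition cons_resolution K P X (k : K ~> P) (e : P ~> X)
    (ke : presentation k e) (R : projective_resolution K) :
  projective_resolution X.
Proof.
pose ob n := if n is m.+1 then R m else P.
pose d n : ob n.+1 ~> ob n :=
  if n is m.+1 then res_d R m else k ∘ res_aug R.
refine (@ProjectiveResolution A X ob d e _ _ _ _).
- by case=> [|n]; [case: ke|apply: res_proj].
- case=> [|n]; last exact: res_exact.
  apply: exact_comp_mono (res_exact0 R); apply: ker_mono.
  by case: ke => _ _; apply.
- exact: cons_resolution_exact.
- by case: ke.
Defined.

(** A state of the recursion that builds a resolution: the projective just chosen, and its subobject
    that the next projective has to cover. *)
Record syzygy := Syzygy {
  syz_proj : A;
  syz_ob : A;
  syz_incl : syz_ob ~> syz_proj;
  syz_is_proj : is_projective syz_proj;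
  syz_mono : is_mono syz_incl }.

Lemma syzygy_next (s : syzygy) : exists (t : syzygy) (e : syz_proj t ~> syz_ob s),
  presentation (syz_incl t) e.
Proof.
have [K [P [k [e ke]]]] := presentation_exists (syz_ob s).
case: (ke) => Pp ee kP.
by exists (Syzygy Pp (ker_mono kP)), e.
Qed.

Lemma resolution_exists X : inhabited (projective_resolution X).
Proof.
pose next s := projT1 (cid (syzygy_next s)).
have nextP s : exists e : syz_proj (next s) ~> syz_ob s,
  presentation (syz_incl (next s)) e by exact: projT2 (cid (syzygy_next s)).
have [K [P [k [a [Pp ae kP]]]]] := presentation_exists X.
pose st := fix st n := if n is m.+1 then next (st m) else Syzygy Pp (ker_mono kP).
pose e n := projT1 (cid (nextP (st n))).
have eP n : presentation (syz_incl (st n.+1)) (e n).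
  exact: projT2 (cid (nextP (st n))).
split; refine (@ProjectiveResolution A X (fun n => syz_proj (st n))
  (fun n => syz_incl (st n) ∘ e n) a _ _ _ ae).
- by move=> n; apply: syz_is_proj.
- move=> n; apply: exact_comp_mono; first exact: syz_mono.
  have [_ _ kn] := eP n; have [_ ee _] := eP n.+1.
  by exists _, (syz_incl (st n.+1)), (e n.+1).
- by have [_ ee _] := eP 0%N; exists _, k, (e 0%N).
Qed.

(** [W] is the cokernel of [K -> K' + P], so a morphism out of [W] is a
    compatible pair of morphisms out of [K'] and [P]. *)
Lemma extend_along_mono K P X S K' W (k : K ~> P) (e : P ~> X)
    (m : K' ~> W) (c : W ~> X) :
  presentation k e -> is_ker m c -> is_epi c ->
  (forall phi : K ~> S, exists psi : P ~> S, psi ∘ k = phi) ->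
  forall phi : K' ~> S, exists psi : W ~> S, psi ∘ m = phi.
Proof.
move=> [Pp ee kP] mP ce kS phi.
have [p cp] := Pp _ _ _ ce e.
have [|p' mp'] := ker_lift (h := p ∘ k) mP; first by rewrite compA cp kP.1.
have [psi psik] := kS (phi ∘ p').
have [T [i1 [i2 [p1 [p2 ip]]]]] := ab_biproduct abA K' P.
have [pi11 pi22 pi12 pi21 _] := ip.
have se : is_epi (m ∘ p1 + p ∘ p2).
  apply: epi_on_projectives => Q y Qp.
  have [z ez] := Qp _ _ _ ee (c ∘ y).
  have [|x mx] := ker_lift (h := y - p ∘ z) mP.
    by rewrite compBr compA cp ez subrr.
  exists (i1 ∘ x + i2 ∘ z); rewrite compDr !compDl -!compA.
  rewrite (compAl pi11) (compAl pi12) (compAl pi21) (compAl pi22).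
  by rewrite !comp0m !comp1m !compm0 addr0 add0r mx subrK.
have [|u uE] := epi_factor (h := phi ∘ p1 + psi ∘ p2) se.
  move=> U x sx0; have ep2 : e ∘ (p2 ∘ x) = 0.
    move/(congr1 (fun y => c ∘ y)): sx0.
    by rewrite compm0 compDl compDr !compA mP.1 !comp0m add0r cp.
  have [y ky] := ker_lift kP ep2.
  have p1x : p1 ∘ x = - (p' ∘ y).
    apply: (ker_mono mP); rewrite compmN (compAl mp') -compA ky.
    by apply/eqP; rewrite -addr_eq0 !compA -compDl sx0.
  by rewrite compDl -!compA p1x -ky compmN (compAl psik) -compA addNr.
exists u; rewrite -(_ : (m ∘ p1 + p ∘ p2) ∘ i1 = m); last first.
  by rewrite compDl -!compA pi11 pi21 compm0 compm1 addr0.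
by rewrite compA uE compDl -!compA pi11 pi21 compm0 compm1 addr0.
Qed.

(** Forward: in a resolution that starts with the given presentation, [phi] composed with the
    augmentation is a cocycle. Backward: in any resolution a 1-cocycle descends to the kernel of the
    augmentation, and the extension property passes from the given presentation to that kernel. *)
Lemma Ext1P K P X S (k : K ~> P) (e : P ~> X) : presentation k e ->
  Ext_eq0 1 X S <-> forall phi : K ~> S, exists psi : P ~> S, psi ∘ k = phi.
Proof.
move=> ke; split=> [XS phi|kS R phi phid0].
  have [R] := resolution_exists K.
  have [] := XS (cons_resolution ke R) (phi ∘ res_aug R).
    have [K1 [k1 [e1 [[a0 _] dE _]]]] := res_exact0 R.
    by rewrite /= -compA dE (compAl a0) comp0m compm0.
  move=> psi psiE; exists psi; apply: (@res_epi _ _ R).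
  by rewrite -compA -psiE.
have [K' [k' [e' [kP' dE ee']]]] := res_exact0 R.
have e'P : is_coker e' (res_d R 1).
  apply: (exact_coker abA) => //; apply: (exact_comp_monoK (ker_mono kP')).
  by rewrite -dE; apply: res_exact.
have [phi' phiE] := coker_desc e'P phid0.
have [psi psiE] := extend_along_mono ke kP' (@res_epi _ _ R) kS phi'.
by exists psi; rewrite dE compA psiE phiE.
Qed.

(** Exactness of Hom(W, S) -> Hom(K, S) -> Ext^1(X, S). *)
Lemma Ext1_extend X S K W (m : K ~> W) (c : W ~> X) :
  Ext_eq0 1 X S -> is_ker m c -> is_epi c ->
  forall phi : K ~> S, exists psi : W ~> S, psi ∘ m = phi.
Proof.
move=> XS; have [K' [P [k [e ke]]]] := presentation_exists X.
by move=> mP ce; apply: (extend_along_mono ke mP ce); apply/(Ext1P _ ke).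
Qed.

(** Exactness of Hom(X, W) -> Hom(X, Q) -> Ext^1(X, S): a lift [p] of [h ∘ e] restricts on [K] to a
    map into [S], and subtracting an extension of that map makes [p] descend to [X]. *)
Lemma Ext1_lift X S W Q (j : S ~> W) (q : W ~> Q) :
  Ext_eq0 1 X S -> is_ker j q -> is_epi q ->
  forall h : X ~> Q, exists u : X ~> W, q ∘ u = h.
Proof.
move=> XS jP qe h; have [K [P [k [e ke]]]] := presentation_exists X.
have [Pp ee kP] := ke.
have [p qp] := Pp _ _ _ qe (h ∘ e).
have [|phi jphi] := ker_lift (h := p ∘ k) jP.
  by rewrite compA qp -compA kP.1 compm0.
have [psi psik] := (Ext1P _ ke).1 XS phi.
have [||u uE] := coker_desc (c := e) (f := k) (h := p - j ∘ psi).
- exact: epi_coker_ker kP.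
- by rewrite compBl -compA psik jphi subrr.
exists u; apply: ee; rewrite -compA uE compBr qp.
by rewrite compA jP.1 comp0m subr0.
Qed.

(** A section of [e] yields a retraction [r] of [k]. *)
Lemma Ext1_projective P S : is_projective P -> Ext_eq0 1 P S.
Proof.
move=> Pp; have [K [Q [k [e ke]]]] := presentation_exists P.
apply/(Ext1P _ ke) => phi; have [Qp ee kP] := ke.
have [s es] := Pp _ _ _ ee (idm P).
have [|r kr] := ker_lift (h := idm Q - s ∘ e) kP.
  by rewrite compBr compm1 compA es comp1m subrr.
exists (phi ∘ r); rewrite -compA.
rewrite (_ : r ∘ k = idm K) ?compm1 //; apply: (ker_mono kP).
by rewrite compA kr compBl comp1m -compA kP.1 compm0 subr0 compm1.
Qed.

Lemma Ext1_injective X I : is_injective I -> Ext_eq0 1 X I.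
Proof.
move=> Ii; have [K [Q [k [e ke]]]] := presentation_exists X.
by apply/(Ext1P _ ke) => phi; apply: Ii; case: ke => _ _ /ker_mono.
Qed.

(** * Dimension shift and hereditary cotorsion pairs *)

Lemma Ext2_syzygy K P X S (k : K ~> P) (e : P ~> X) :
  presentation k e -> Ext_eq0 2 X S -> Ext_eq0 1 K S.
Proof. by move=> ke XS R phi; apply: (XS (cons_resolution ke R)). Qed.

(** Each of the first three conditions keeps syzygies of objects of [C] in [C]. A map from such a
    syzygy to [Q] then lifts to [Y], extends to the projective, and is pushed back to [Q].
    Injectives do not enter, so this applies in the extension. *)
Lemma hereditary_closed_coker (C D : set A) : cotorsion_pair C D ->
  hereditary C D -> closed_coker_mono D.
Proof.
(* Assuming the conclusion false discards the fourth condition, so that [syz] covers the other three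
   at once. *)
move=> [CE DE] her; case: (pselect (closed_coker_mono D)) => // nD.
have CD X Y : C X -> D Y -> Ext_eq0 1 X Y by rewrite {1}CE => /[apply].
have syz K P X (k : K ~> P) (e : P ~> X) : presentation k e -> C X -> C K.
  move=> ke CX; case: her => [H|H|H|//].
  - by rewrite CE => Y DY; apply: (Ext2_syzygy ke); apply: H.
  - by rewrite CE => Y DY; apply: (Ext2_syzygy ke); apply: H.
  - have [Pp ee kP] := ke; apply: (H _ _ _ _ _ ee kP) => //.
    by rewrite CE => Y _; apply: Ext1_projective.
move=> X Y Q m c mm cP DX DY; rewrite DE => M CM.
have [K [P [k [e ke]]]] := presentation_exists M.
apply/(Ext1P _ ke) => phi.
have [psi cpsi] := Ext1_lift (CD _ _ (syz _ _ _ _ _ ke CM) DX)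
  (mono_ker_coker abA mm cP) (coker_epi cP) phi.
have [psi' psi'k] := (Ext1P _ ke).1 (CD _ _ CM DY) psi.
by exists (c ∘ psi'); rewrite -compA psi'k.
Qed.

(** Embed [S] in an injective [I]; the quotient [Q] is in [D]. A map [phi] from the syzygy of [K]
    extends to [h] with values in [I], inducing [g] from [K] to [Q]. As Ext^1(Y, Q) = 0 and Ext^1(X,
    S) = 0, [g] extends to [X] and lifts to [I]; subtracting this lift from [h] leaves a map into
    [S] that extends [phi]. *)
Lemma closed_coker_closed_ker (C D : set A) : enough_injectives A ->
  cotorsion_pair C D -> closed_coker_mono D -> closed_ker_epi C.
Proof.
move=> enI [CE DE] clD K X Y k e ee kP CX CY.
have CD M N : C M -> D N -> Ext_eq0 1 M N by rewrite {1}CE => /[apply].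
rewrite CE => S DS; have [I [m [Ii mm]]] := enI S.
have [Q [q qP]] := ab_coker abA m.
have mP := mono_ker_coker abA mm qP; have qe := coker_epi qP.
have DQ : D Q.
  by apply: clD mm qP DS _; rewrite DE => M _; apply: Ext1_injective.
have [L [P [l [p lp]]]] := presentation_exists K; have [Pp pe lP] := lp.
apply/(Ext1P _ lp) => phi.
have [h hl] := Ii _ _ _ (ker_mono lP) (m ∘ phi).
have [|g gp] := coker_desc (h := q ∘ h) (epi_coker_ker abA pe lP).
  by rewrite -compA hl compA qP.1 comp0m.
have [g' g'k] := Ext1_extend (CD _ _ CY DQ) kP ee g.
have [g'' qg''] := Ext1_lift (CD _ _ CX DS) mP qe g'.
have [|r mr] := ker_lift (h := h - g'' ∘ k ∘ p) mP.
  by rewrite compBr !compA qg'' g'k gp subrr.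
exists r; apply: (ker_mono mP).
by rewrite compA mr compBl hl -compA lP.1 compm0 subr0.
Qed.

End Chase.

(** * Vanishing of L_1 F as left exactness of F on short exact sequences *)

Section LeftDerived.
Variables (A B : abelian) (F : additive_functor A B).
Hypotheses (enA : enough_projectives A) (enB : enough_projectives B).
Hypothesis Frex : right_exact F.

(** An element killed by [fmap F k] lifts along the augmentation of [R] to a 1-cycle of the spliced
    resolution; this is a boundary, hence zero in [F K]. *)
Lemma left_derived1_mono K P X (k : K ~> P) (e : P ~> X) :
  presentation k e -> left_derived_eq0 F 1 X -> is_mono (fmap F k).
Proof.
move=> ke FX; have [R] := resolution_exists enA K.
pose R' := cons_resolution ke R.
have [J [j jP]] := ab_ker (ab_ax B) (fmap F (res_d R' 0)).
have aP : is_coker (res_aug R) (res_d R 0).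
  by apply: (exact_coker (ab_ax A)); [apply: res_exact0|apply: res_epi].
have FaP := right_exact_coker Frex aP.
(* By the degree shift [res_d R' 1] is [res_d R 0], which the augmentation of [R] kills. *)
have [|f jf] := ker_lift (h := fmap F (res_d R' 1)) jP.
  by rewrite -fmapM /= -compA aP.1 compm0 fmap0.
have [H [c cP]] := ab_coker (ab_ax B) f.
have c0 : c = 0 by apply: (FX H _).2; exists R', J, j, f, c.
apply: (mono_on_projectives enB) => Q x Qp kx0.
have [y ay] := Qp _ _ _ (coker_epi FaP) x.
have [|z jz] := ker_lift (h := y) jP.
  by rewrite /= fmapM -compA ay.
have [|w fw] := exact_on_projective (x := z) Qp cP; first by rewrite c0 comp0m.
by rewrite -ay -jz -fw (compAl jf) compA FaP.1 comp0m.
Qed.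

(** Comparison with a presentation [L -> P -> X] makes [s : K + P -> W] the cokernel of
    [j = (p', - l)]. If [fmap F k] kills [x], then [(x, 0)] comes from some [z] in [F L], and [z]
    vanishes because [fmap F l] is mono. *)
Lemma left_derived1_mono_of_ker K W X (k : K ~> W) (e : W ~> X) :
  is_ker k e -> is_epi e -> left_derived_eq0 F 1 X -> is_mono (fmap F k).
Proof.
move=> kP ee FX; have [L [P [l [a la]]]] := presentation_exists enA X.
have [Pp ae lP] := la; have Fl := left_derived1_mono la FX.
have [p ep] := Pp _ _ _ ee a.
have [|p' kp'] := ker_lift (h := p ∘ l) kP; first by rewrite compA ep lP.1.
have [S [i1 [i2 [p1 [p2 ip]]]]] := ab_biproduct (ab_ax A) K P.
have [pi11 pi22 pi12 pi21 _] := ip.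
pose s := k ∘ p1 + p ∘ p2; pose j := i1 ∘ p' - i2 ∘ l.
have p1j : p1 ∘ j = p'.
  by rewrite compBr !compA pi11 pi12 comp1m comp0m subr0.
have p2j : p2 ∘ j = - l.
  by rewrite compBr !compA pi21 pi22 comp1m comp0m sub0r.
have sj0 : s ∘ j = 0 by rewrite compDl -!compA p1j p2j kp' compmN subrr.
have si1 : s ∘ i1 = k.
  by rewrite compDl -!compA pi11 pi21 compm1 compm0 addr0.
have si2 : s ∘ i2 = p.
  by rewrite compDl -!compA pi12 pi22 compm1 compm0 add0r.
have se : is_epi s.
  apply: (epi_on_projectives enA) => Q y Qp.
  have [z az] := Qp _ _ _ ae (e ∘ y).
  have [|x kx] := ker_lift (h := y - p ∘ z) kP.
    by rewrite compBr compA ep az subrr.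
  exists (i1 ∘ x + i2 ∘ z).
  by rewrite compDr (compAl si1) (compAl si2) kx subrK.
have sP : is_coker s j.
  apply: (coker_on_projectives enA) => // Q x Qp sx0.
  have sE : k ∘ (p1 ∘ x) + p ∘ (p2 ∘ x) = 0 by rewrite -sx0 compDl !compA.
  have [|y ly] := ker_lift (h := - (p2 ∘ x)) lP.
    rewrite compmN -ep -compA; move/(congr1 (fun y => e ∘ y)): sE.
    by rewrite compDr (compAl kP.1) comp0m add0r compm0 => ->; rewrite oppr0.
  exists y; rewrite (biproduct_split x ip) /j compBl -!compA ly compmN opprK.
  congr (i1 ∘ _ + _); apply: (ker_mono kP); rewrite (compAl kp') -compA ly.
  by apply/eqP; rewrite compmN eq_sym -addr_eq0 sE.
have FsP := right_exact_coker Frex sP.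
apply: (mono_on_projectives enB) => Q x Qp kx0.
have [|z jz] := exact_on_projective (x := fmap F i1 ∘ x) Qp FsP.
  by rewrite compA -fmapM si1.
have z0 : z = 0.
  apply: (mono_eq0 Fl); apply: oppr_inj; rewrite oppr0 -compNm -fmapN -p2j fmapM.
  by rewrite -compA jz compA -fmapM pi21 fmap0 comp0m.
by rewrite -(comp1m x) -fmap1 -pi11 fmapM -compA -jz z0 !compm0.
Qed.

End LeftDerived.

(** * The extension category: underlying kernels and cokernels, zero structure maps, free objects *)

Section Extension.
Variables (B : abelian) (F : additive_functor B B).
Variable eta : nat_trans (compF F F) F.
Hypothesis Frex : right_exact F.
Local Notation E := (extension eta Frex).
Let abB := ab_ax B.

(** The given kernel is compared with the one lifted from a kernel in [B]. *)
Lemma ext_is_ker_mor (K X Y : E) (k : K ~> X) (a : X ~> Y) :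
  is_ker k a -> is_ker (mor k) (mor a).
Proof.
move=> kP; have [K' [k' k'P]] := ext_ker_lift a.
have [|u ku] := ker_lift (h := k') kP.
  by apply: val_inj; exact: k'P.1.
apply: is_kerI => [||Z h].
- by apply/ext_monoP; apply: ker_mono kP.
- exact: (congr1 (@mor _ _ _ _ _) kP.1).
- move=> /(ker_lift k'P)[w <-]; exists (mor u ∘ w).
  by rewrite compA -[mor k ∘ mor u]/(mor (k ∘ u)) ku.
Qed.

Lemma ext_is_coker_mor (X Y Q : E) (c : Y ~> Q) (a : X ~> Y) :
  is_coker c a -> is_coker (mor c) (mor a).
Proof.
move=> cP; have [Q' [c' c'P]] := ext_coker_lift Frex a.
have [|u uc] := coker_desc (h := c') cP.
  by apply: val_inj; exact: c'P.1.
apply: is_cokerI => [||Z h].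
- by apply/(ext_epiP Frex); apply: coker_epi cP.
- exact: (congr1 (@mor _ _ _ _ _) cP.1).
- move=> /(coker_desc c'P)[w <-]; exists (w ∘ mor u).
  by rewrite -compA -[mor u ∘ mor c]/(mor (u ∘ c)) uc.
Qed.

Fact triv_subproof (X : B) : (0 : F X ~> X) ∘ fmap F 0 = 0 ∘ eta X.
Proof. by rewrite !comp0m. Qed.

Definition triv (X : B) : E := ExtOb (triv_subproof X).

Fact triv_map_subproof (X Y : B) (f : X ~> Y) : ext_hom_pred (triv X) (triv Y) f.
Proof. by rewrite /= comp0m compm0. Qed.

Definition triv_map (X Y : B) (f : X ~> Y) : triv X ~> triv Y :=
  ExtHom (triv_map_subproof f).

Lemma triv_mono (X Y : B) (f : X ~> Y) : is_mono f -> is_mono (triv_map f).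
Proof. by move=> fm; apply: ext_mono. Qed.

Lemma triv_coker (X Y Q : B) (f : X ~> Y) (c : Y ~> Q) :
  is_coker c f -> is_coker (triv_map c) (triv_map f).
Proof. by move=> cP; apply: ext_is_coker. Qed.

(** [T] is the object [P + F P] of the extension, free on [P]. *)
Definition is_free (P : B) (T : E) (i1 : P ~> carrier T)
    (i2 : F P ~> carrier T) (p1 : carrier T ~> P) (p2 : carrier T ~> F P) :=
  is_biproduct i1 i2 p1 p2 /\
  str T = i2 ∘ (fmap F p1 + eta P ∘ fmap F p2).

Lemma free_str_unit (P : B) (T : E) (i1 : P ~> carrier T) i2 p1 p2 :
  is_free i1 i2 p1 p2 -> str T ∘ fmap F i1 = i2.
Proof.
move=> [[pi11 _ _ pi21 _] ->].
by rewrite -compA compDl -compA -!fmapM pi11 pi21 fmap1 fmap0 compm0 addr0 compm1.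
Qed.

Lemma free_mor_i2 (P : B) (T Y : E) (i1 : P ~> carrier T) i2 p1 p2
    (h : T ~> Y) : is_free i1 i2 p1 p2 ->
  mor h ∘ i2 = str Y ∘ fmap F (mor h ∘ i1).
Proof.
by move=> fT; rewrite -(free_str_unit fT) compA (ext_homE h) fmapM compA.
Qed.

Lemma free_morE (P : B) (T Y : E) (i1 : P ~> carrier T) i2 p1 p2
    (h : T ~> Y) : is_free i1 i2 p1 p2 ->
  mor h = mor h ∘ i1 ∘ p1 + str Y ∘ fmap F (mor h ∘ i1) ∘ p2.
Proof.
move=> fT; rewrite -(free_mor_i2 _ fT) -!compA -compDr.
by case: fT => -[_ _ _ _ ->] _; rewrite compm1.
Qed.

(** The formula for the morphism is forced by [free_morE]. *)
Lemma free_mapP (P : B) (T Y : E) (i1 : P ~> carrier T) i2 p1 p2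
    (b : P ~> carrier Y) : is_free i1 i2 p1 p2 ->
  exists h : T ~> Y, mor h ∘ i1 = b.
Proof.
move=> [[pi11 pi22 pi12 pi21 ip] tE].
have hP : ext_hom_pred T Y (b ∘ p1 + str Y ∘ fmap F b ∘ p2).
  apply/eqP; rewrite tE compDl -!compA !(compA _ i2) pi12 pi22 comp0m compm0.
  rewrite add0r comp1m !fmapD !fmapM !compDr; congr (_ + _).
  by rewrite !(compA (str Y)) strP -!compA (compA (eta _)) (nt_natural eta) !compA.
exists (ExtHom hP) => /=.
by rewrite compDl -!compA pi11 pi21 !compm0 compm1 addr0.
Qed.

Lemma free_mor_inj (P : B) (T Y : E) (i1 : P ~> carrier T) i2 p1 p2
    (g h : T ~> Y) : is_free i1 i2 p1 p2 ->
  mor g ∘ i1 = mor h ∘ i1 -> g = h.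
Proof.
by move=> fT gh; apply: val_inj; rewrite /= (free_morE g fT) gh -(free_morE h fT).
Qed.

Lemma free_projective (P : B) (T : E) (i1 : P ~> carrier T) i2 p1 p2 :
  is_free i1 i2 p1 p2 -> is_projective P -> is_projective T.
Proof.
move=> fT Pp Y Z e /(ext_epiP Frex) ee h.
have [b eb] := Pp _ _ _ ee (mor h ∘ i1).
have [g gb] := free_mapP b fT; exists g; apply: (free_mor_inj fT).
by rewrite /= -compA gb.
Qed.

Hypothesis eta_assoc : assoc_nt eta.

Lemma free_exists (P : B) : exists (T : E) (i1 : P ~> carrier T) i2 p1 p2,
  is_free i1 i2 p1 p2.
Proof.
have [S [i1 [i2 [p1 [p2 ip]]]]] := ab_biproduct abB P (F P).
have [pi11 pi22 pi12 pi21 _] := ip.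
pose m : F S ~> F P := fmap F p1 + eta P ∘ fmap F p2.
have tP : i2 ∘ m ∘ fmap F (i2 ∘ m) = i2 ∘ m ∘ eta S.
  rewrite -!compA; congr (_ ∘ _).
  rewrite {1}/m compDl -compA -!fmapM !compA pi12 pi22 comp1m comp0m fmap0.
  rewrite add0r fmapD fmapM compDl !compDr !compA eta_assoc -!compA.
  by rewrite !(nt_natural eta).
by exists (ExtOb tP), i1, i2, p1, p2.
Qed.

(** * Ext^1 out of free objects and into objects with zero structure map *)

Hypothesis enB : enough_projectives B.

Let enE : enough_projectives E := ext_enough_projectives Frex eta_assoc enB.

(** As [fmap F k] is mono, the free objects on [K] and [P] present [T], and the extension problems
    on both sides correspond under the adjunction. *)
Lemma Ext1_free (X : B) (T M : E) (i1 : X ~> carrier T) i2 p1 p2 :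
  is_free i1 i2 p1 p2 -> left_derived_eq0 F 1 X ->
  Ext_eq0 1 T M <-> Ext_eq0 1 X (carrier M).
Proof.
move=> fT FX; have [K [P [k [e ke]]]] := presentation_exists enB X.
have [Pp ee kP] := ke.
have Fkm := left_derived1_mono enB enB Frex ke FX.
have FeP := right_exact_coker Frex (epi_coker_ker abB ee kP).
have FkP := mono_ker_coker abB Fkm FeP.
have [TP [j1 [j2 [q1 [q2 fP]]]]] := free_exists P.
have [TK [l1 [l2 [r1 [r2 fK]]]]] := free_exists K.
have [te teE] := free_mapP (Y := T) (i1 ∘ e) fP.
have [tk tkE] := free_mapP (Y := TP) (j1 ∘ k) fK.
have teE2 : mor te ∘ j2 = i2 ∘ fmap F e.
  by rewrite (free_mor_i2 _ fP) teE fmapM compA (free_str_unit fT).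
have tkE2 : mor tk ∘ l2 = j2 ∘ fmap F k.
  by rewrite (free_mor_i2 _ fK) tkE fmapM compA (free_str_unit fP).
have tkx Z (x : Z ~> carrier TK) :
    mor tk ∘ x = j1 ∘ (k ∘ (r1 ∘ x)) + j2 ∘ (fmap F k ∘ (r2 ∘ x)).
  by rewrite {1}(biproduct_split x fK.1) compDr (compAl tkE) (compAl tkE2) !compA.
have tex Z (x : Z ~> carrier TP) :
    mor te ∘ x = i1 ∘ (e ∘ (q1 ∘ x)) + i2 ∘ (fmap F e ∘ (q2 ∘ x)).
  by rewrite {1}(biproduct_split x fP.1) compDr (compAl teE) (compAl teE2) !compA.
have sum0 Q (T' : E) (a1 : Q ~> carrier T') a2 b1 b2 (Z : B) (x : Z ~> Q) y :
    is_free a1 a2 b1 b2 -> a1 ∘ x + a2 ∘ y = 0 -> x = 0 /\ y = 0.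
  move=> [[ba11 ba22 ba12 ba21 _] _] xy0; split.
    move/(congr1 (fun z => b1 ∘ z)): xy0.
    by rewrite compDr !compA ba11 ba12 comp0m comp1m addr0 compm0.
  move/(congr1 (fun z => b2 ∘ z)): xy0.
  by rewrite compDr !compA ba21 ba22 comp0m comp1m add0r compm0.
have pres : presentation tk te.
  split; first exact: free_projective fP Pp.
    apply/is_epiP => Z g gte0; apply: (free_mor_inj fT); rewrite /= comp0m.
    apply: (epi_eq0 ee); rewrite -compA -teE compA.
    by rewrite -[mor g ∘ _]/(mor (g ∘ te)) gte0 /= comp0m.
  apply: ext_is_ker; apply: is_kerI.
  - apply/is_monoP => Z x; rewrite tkx => /(sum0 _ _ _ _ _ _ _ _ _ fP)[].
    move=> /(mono_eq0 (ker_mono kP)) x1 /(mono_eq0 Fkm) x2.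
    by rewrite (biproduct_split x fK.1) x1 x2 !compm0 addr0.
  - have te_tk : te ∘ tk = 0.
      apply: (free_mor_inj fK); rewrite /= comp0m -compA tkE (compAl teE).
      by rewrite -compA kP.1 compm0.
    exact: (congr1 (@mor _ _ _ _ _) te_tk).
  - move=> Z h; rewrite tex => /(sum0 _ _ _ _ _ _ _ _ _ fT)[].
    move=> /(ker_lift kP)[y ky] /(ker_lift FkP)[z kz].
    exists (l1 ∘ y + l2 ∘ z).
    rewrite compDr (compAl tkE) (compAl tkE2) -!compA ky kz.
    by rewrite -(biproduct_split h fP.1).
rewrite (Ext1P enE M pres) (Ext1P enB _ ke); split=> ext phi.
  have [h hE] := free_mapP phi fK; have [psi psiE] := ext h.
  by exists (mor psi ∘ j1); rewrite -hE -psiE /= -!compA tkE.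
have [psi0 psi0E] := ext (mor phi ∘ l1); have [psi psiE] := free_mapP psi0 fP.
exists psi; apply: (free_mor_inj fK).
by rewrite /= -compA tkE compA psiE.
Qed.

(** [M] is presented by the free object [T] on [P], with kernel [K]. The cokernels of the structure
    maps of [K] and [T] are [L] and [P], which present [Q]; maps into [triv Y] are maps out of these
    cokernels. *)
Lemma Ext1_triv (M : E) (Q Y : B) (c : carrier M ~> Q) :
  is_mono (str M) -> is_coker c (str M) ->
  Ext_eq0 1 M (triv Y) <-> Ext_eq0 1 Q Y.
Proof.
move=> fm cP; have [N [P [n [e [Pp ee nP]]]]] := presentation_exists enB (carrier M).
have FeP := right_exact_coker Frex (epi_coker_ker abB ee nP).
have [T [i1 [i2 [p1 [p2 fT]]]]] := free_exists P.
have [[pi11 pi22 pi12 pi21 _] _] := fT.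
have [te teE] := free_mapP e fT.
have teE2 : mor te ∘ i2 = str M ∘ fmap F e by rewrite (free_mor_i2 _ fT) teE.
have tee : is_epi te.
  apply: ext_epi; apply/is_epiP => Z g g0.
  by apply: (epi_eq0 ee); rewrite -teE compA g0 comp0m.
have [K [ka kaP]] := ab_ker (ab_ax E) te.
have kaP' := ext_is_ker_mor kaP.
have pres : presentation ka te by split=> //; apply: free_projective fT Pp.
have cee : is_epi (c ∘ e) := is_epi_comp (coker_epi cP) ee.
have [L [l lP]] := ab_ker abB (c ∘ e).
have presL : presentation l (c ∘ e) by [].
have cte : c ∘ mor te = c ∘ e ∘ p1.
  rewrite (free_morE te fT) teE compDr !compA cP.1 !comp0m addr0 //.
have [|la laE] := ker_lift (h := p1 ∘ mor ka) lP.
  by rewrite compA -cte -compA kaP'.1 compm0.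
have p1s : p1 ∘ str T = 0 by rewrite fT.2 compA pi12 comp0m.
(* Here [str M] must be mono: an element of [K] killed by [la] is some [i2 ∘ w] with
   [fmap F e ∘ w = 0], so [w] comes from [F N], and [nu : N -> K] carries it into the image of
   [str K]. *)
have laP : is_coker la (str K).
  apply: (coker_on_projectives enB).
  - apply: (epi_on_projectives enB) => R y Rp.
    have [|z fz] := exact_on_projective (x := e ∘ (l ∘ y)) Rp cP.
      by rewrite !compA lP.1 comp0m.
    have [w ew] := Rp _ _ _ (coker_epi FeP) z.
    have [|x kx] := ker_lift (h := i1 ∘ (l ∘ y) - i2 ∘ w) kaP'.
      by rewrite compBr (compAl teE) (compAl teE2) -!compA ew fz subrr.
    exists x; apply: (ker_mono lP); rewrite (compAl laE) -compA kx compBr !compA.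
    by rewrite pi11 pi12 comp1m comp0m subr0.
  - apply: (ker_mono lP); rewrite (compAl laE) -compA ext_homE (compAl p1s).
    by rewrite comp0m compm0.
  - move=> R x Rp lax0.
    have p1x : p1 ∘ (mor ka ∘ x) = 0.
      by rewrite compA -laE -compA lax0 compm0.
    have kx := biproduct_split (mor ka ∘ x) fT.1.
    rewrite p1x compm0 add0r in kx; set w := p2 ∘ _ in kx.
    have [|v nv] := exact_on_projective (x := w) Rp FeP.
      apply: (mono_eq0 fm); rewrite compA -teE2 -compA -kx compA.
      by rewrite kaP'.1 comp0m.
    have [|nu nuE] := ker_lift (h := i1 ∘ n) kaP'.
      by rewrite compA teE nP.1.
    exists (fmap F nu ∘ v); apply: (ker_mono kaP').
    rewrite compA (ext_homE ka) -compA (compA (fmap F _)) -fmapM nuE fmapM.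
    by rewrite -compA (compAl (free_str_unit fT)) nv.
rewrite (Ext1P enE (triv Y) pres) (Ext1P enB _ presL); split=> ext phi.
  have phiP : ext_hom_pred K (triv Y) (phi ∘ la).
    by rewrite /= -compA laP.1 compm0 comp0m.
  have [psi psiE] := ext (ExtHom phiP).
  exists (mor psi ∘ i1); apply: (coker_epi laP).
  rewrite -[RHS]/(mor (ExtHom phiP)) -psiE /= -!compA laE.
  rewrite [in RHS](biproduct_split (mor ka) fT.1) compDr (compA _ i2).
  by rewrite (free_mor_i2 psi fT) /= !comp0m addr0.
have [|phi' phiE] := coker_desc (h := mor phi) laP.
  by rewrite (ext_homE phi) comp0m.
have [psi psiE] := ext phi'.
have psiP : ext_hom_pred T (triv Y) (psi ∘ p1).
  by rewrite /= -compA p1s compm0 comp0m.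
exists (ExtHom psiP); apply: val_inj => /=.
by rewrite -compA -laE compA psiE phiE.
Qed.

Lemma exact_from_zero (Z X Y : B) (u : Z ~> X) (f : X ~> Y) :
  is_zero Z -> exact u f <-> is_mono f.
Proof.
move=> Z0; split=> [[K [k [e [kP _ ee]]]]|fm].
  have K0 : idm K = 0 by apply: (epi_eq0 ee); rewrite (Z0.1 _ e) compm0.
  apply/is_monoP => T x /(ker_lift kP)[v <-].
  by rewrite -(comp1m v) K0 comp0m compm0.
exists Z, u, (idm Z); split.
- apply: is_kerI; first by move=> T g h _; rewrite (Z0.2 _ g) (Z0.2 _ h).
    exact: Z0.1.
  by move=> T h /(mono_eq0 fm) ->; exists 0; rewrite compm0.
- by rewrite compm1.
- by move=> T g h; rewrite !compm1.
Qed.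

(** * The class Delta when F^2 = 0 *)

Section SquareZero.
Hypothesis FF0 : forall M : B, is_zero (F (F M)).

Lemma DeltaP (X : set B) (M : E) : Delta eta Frex X M <->
  is_mono (str M) /\ exists Q (c : carrier M ~> Q), is_coker c (str M) /\ X Q.
Proof.
by rewrite -(exact_from_zero (fmap F (str M) - eta (carrier M)) (str M) (FF0 _)).
Qed.

(** An extension of [M] by [(I, 0)] splits over [B], hence is given by some
    [h : F M -> I]; it splits in the extension iff [h] factors through
    [str M]. *)
Lemma Ext1_injective_factor (M : E) (I : B) (h : F (carrier M) ~> I) :
  Ext_eq0 1 M (triv I) -> exists u, u ∘ str M = h.
Proof.
move=> MI; have [S [i1 [i2 [p1 [p2 ip]]]]] := ab_biproduct abB I (carrier M).
have [pi11 pi22 pi12 pi21 _] := ip.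
pose g := (i1 ∘ h + i2 ∘ str M) ∘ fmap F p2.
have gP : g ∘ fmap F g = g ∘ eta S.
  by rewrite ((FF0 S).1 _ (g ∘ fmap F g)) ((FF0 S).1 _ (g ∘ eta S)).
pose W : E := ExtOb gP.
have i1P : ext_hom_pred (triv I) W i1.
  by rewrite /= compm0 -compA -fmapM pi21 fmap0 compm0.
have p2P : ext_hom_pred W M p2.
  by rewrite /= compA compDr !compA pi21 pi22 comp0m comp1m add0r.
have kerP : is_ker (ExtHom i1P : triv I ~> W) (ExtHom p2P : W ~> M).
  apply: ext_is_ker; apply: is_kerI => /=.
  - by apply/is_monoP => Z x x0; rewrite -(comp1m x) -pi11 -compA x0 compm0.
  - by [].
  - move=> Z x p2x; exists (p1 ∘ x).
    by rewrite [RHS](biproduct_split x ip) p2x compm0 addr0.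
have epiP : is_epi (ExtHom p2P : W ~> M).
  apply: ext_epi => /=; apply/is_epiP => Z x x0.
  by rewrite -(compm1 x) -pi22 compA x0 comp0m.
have [s /(congr1 (@mor _ _ _ _ _)) /= ps] := Ext1_lift enE MI kerP epiP (idm M).
exists (p1 ∘ mor s); rewrite -compA (ext_homE s) /= -compA -fmapM ps fmap1 compm1.
by rewrite compDr !compA pi11 pi12 comp1m comp0m addr0.
Qed.

(** An embedding of [F (carrier M)] into an injective factors through [str M]. *)
Lemma Ext1_triv_mono (M : E) (D : set B) : enough_injectives B ->
  (forall I, is_injective I -> D I) ->
  (forall N, D N -> Ext_eq0 1 M (triv N)) -> is_mono (str M).
Proof.
move=> enI injD MD; have [I [h [Ii hm]]] := enI (F (carrier M)).
have [u uE] := Ext1_injective_factor h (MD _ (injD _ Ii)).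
by apply/is_monoP => Z x x0; apply: (mono_eq0 hm); rewrite -uE -compA x0 compm0.
Qed.

(** Since [fmap F p2] lands in [F (F P)], it vanishes, and [str T] is the composite of the
    monomorphisms [fmap F p1] and [i2]. *)
Lemma Delta_free (X : set B) (P : B) (T : E) (i1 : P ~> carrier T) i2 p1 p2 :
  is_free i1 i2 p1 p2 -> X P -> Delta eta Frex X T /\ is_coker p1 (str T).
Proof.
move=> fT XP; have [[pi11 pi22 pi12 pi21 ip] tE] := fT.
have cP : is_coker p1 (str T).
  apply: is_cokerI => [||Z h h0].
  - by apply/is_epiP => Z x x0; rewrite -(compm1 x) -pi11 compA x0 comp0m.
  - by rewrite tE compA pi12 comp0m.
  - exists (h ∘ i1); rewrite -[RHS]compm1 -ip compDr !compA -(free_str_unit fT).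
    by rewrite compA h0 !comp0m addr0.
split=> //; apply/DeltaP; split; last by exists P, p1.
apply/is_monoP => Z x; rewrite tE => x0.
have F20 : fmap F p2 = 0 by exact: (FF0 P).2.
rewrite F20 compm0 addr0 in x0.
have p1x : fmap F p1 ∘ x = 0.
  by rewrite -(comp1m (_ ∘ x)) -pi22 -compA (compA i2) x0 compm0.
rewrite -(comp1m x) -fmap1 -ip fmapD !fmapM F20 compm0 addr0 -compA p1x.
exact: compm0.
Qed.

(** As [str M2] is mono, a snake-type chase identifies the kernel [L] of [q : Q1 -> Q2] with the
    cokernel of [str K]. Moreover [fmap F la] is mono because F^2 = 0, and [fmap F l] because L_1 F
    (Q2) = 0. Anything killed by [str K] is killed by [fmap F ka], hence by [fmap F l ∘ fmap F la],
    and so vanishes. *)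
Lemma Delta_closed_ker (X : set B) :
  (forall M, X M -> left_derived_eq0 F 1 M) ->
  closed_ker_epi X -> closed_ker_epi (Delta eta Frex X).
Proof.
move=> FX clX K M1 M2 ka ep /(ext_epiP Frex) epe /ext_is_ker_mor kaP.
move=> /DeltaP[f1m [Q1 [c1 [c1P XQ1]]]] /DeltaP[f2m [Q2 [c2 [c2P XQ2]]]].
have [|q qE] := coker_desc (h := c2 ∘ mor ep) c1P.
  by rewrite -compA ext_homE compA c2P.1 comp0m.
have qe : is_epi q.
  apply/is_epiP => Z x x0; apply: (epi_eq0 (is_epi_comp (coker_epi c2P) epe)).
  by rewrite -qE compA x0 comp0m.
have [L [l lP]] := ab_ker abB q.
have [|la laE] := ker_lift (h := c1 ∘ mor ka) lP.
  by rewrite compA qE -compA kaP.1 compm0.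
have FepP := right_exact_coker Frex (epi_coker_ker abB epe kaP).
have laP : is_coker la (str K).
  apply: (coker_on_projectives enB).
  - apply: (epi_on_projectives enB) => R y Rp.
    have [x cx] := Rp _ _ _ (coker_epi c1P) (l ∘ y).
    have [|z fz] := exact_on_projective (x := mor ep ∘ x) Rp c2P.
      by rewrite compA -qE -compA cx compA lP.1 comp0m.
    have [w ew] := Rp _ _ _ (coker_epi FepP) z.
    have [|u ku] := ker_lift (h := x - str M1 ∘ w) kaP.
      by rewrite compBr (compAl (ext_homE ep)) -compA ew fz subrr.
    exists u; apply: (ker_mono lP); rewrite (compAl laE) -compA ku compBr.
    by rewrite (compAl c1P.1) comp0m subr0.
  - apply: (ker_mono lP); rewrite (compAl laE) -compA ext_homE.
    by rewrite (compAl c1P.1) comp0m compm0.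
  - move=> R u Rp lau0.
    have [|w fw] := exact_on_projective (x := mor ka ∘ u) Rp c1P.
      by rewrite compA -laE -compA lau0 compm0.
    have [|v kv] := exact_on_projective (x := w) Rp FepP.
      apply: (mono_eq0 f2m); rewrite compA -(ext_homE ep) -compA fw compA.
      by rewrite kaP.1 comp0m.
    exists v; apply: (ker_mono kaP).
    by rewrite compA (ext_homE ka) -compA kv.
have FlaP := right_exact_coker Frex laP.
have Flam : is_mono (fmap F la).
  apply: (mono_on_projectives enB) => R x Rp x0.
  have [y <-] := exact_on_projective Rp FlaP x0.
  by rewrite ((FF0 _).2 _ y) compm0.
have Flm := left_derived1_mono_of_ker enB enB Frex lP qe (FX _ XQ2).
apply/DeltaP; split; last by exists L, la; split=> //; apply: clX qe lP _ _.
apply/is_monoP => Z v kv0; apply: (mono_eq0 (is_mono_comp Flm Flam)).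
rewrite -fmapM laE fmapM -compA [fmap F (mor ka) ∘ v](_ : _ = 0) ?compm0 //.
by apply: (mono_eq0 f1m); rewrite compA -(ext_homE ka) -compA kv0 compm0.
Qed.

End SquareZero.
End Extension.
Arguments triv_mono {B F} eta Frex {X Y f} _.
Arguments triv_coker {B F} eta Frex {X Y Q f c} _.

(** * The two cotorsion pairs in the extension and their heredity *)

Theorem theoremA (B : abelian) (enough_proj : enough_projectives B)
    (enough_inj : enough_injectives B)
    (F : additive_functor B B) (F_rex : right_exact F)
    (eta : nat_trans (compF F F) F) (eta_assoc : assoc_nt eta)
    (X Y : set B) (XY_cotorsion : cotorsion_pair X Y) :
  let UY : set (extension eta F_rex) := forget eta F_rex @^-1` Y in
  let DX : set (extension eta F_rex) := Delta eta F_rex X in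
  ((forall M : B, X M -> left_derived_eq0 F 1 M) ->
     cotorsion_pair (perp_l UY) UY /\
     (hereditary (perp_l UY) UY <-> hereditary X Y)) /\
  ((forall M : B, is_zero (F (F M))) ->
     cotorsion_pair DX (perp_r DX) /\
     ((forall M : B, X M -> left_derived_eq0 F 1 M) ->
        (hereditary DX (perp_r DX) <-> hereditary X Y))).
Proof.
move=> UY DX; have [XE YE] := XY_cotorsion.
have enE : enough_projectives (extension eta F_rex).
  exact: ext_enough_projectives.
have XY_Ext1 M N : X M -> Y N -> Ext_eq0 1 M N by rewrite {1}XE => /[apply].
split=> [FX|FF0].
  have UY_pair : cotorsion_pair (perp_l UY) UY.
    split=> //; rewrite eqEsubset; split=> [M YM N|M MP]; first by apply.
    rewrite /UY /= YE => N XN.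
    (* Free objects on members of [X] are left orthogonal to [UY], and suffice to test membership in
       it. *)
    have [T [i1 [i2 [p1 [p2 fT]]]]] := free_exists F_rex eta_assoc N.
    have free_Ext1 M' := Ext1_free eta_assoc enough_proj M' fT (FX _ XN).
    apply/free_Ext1; apply: MP => M' YM'; apply/free_Ext1; exact: XY_Ext1.
  split=> //; split=> her.
    have clUY := hereditary_closed_coker enE UY_pair her.
    apply: Or44 => M N Q m c mm cP YM YN.
    have tm := triv_mono eta F_rex mm; have tcP := triv_coker eta F_rex cP.
    exact: clUY tm tcP YM YN.
  have clY := hereditary_closed_coker enough_proj XY_cotorsion her.
  apply: Or44 => M N Q m c /ext_monoP mm /ext_is_coker_mor cP.
  exact: clY mm cP.
have injY I : is_injective I -> Y I.
  by move=> Ii; rewrite YE => N _; apply: Ext1_injective.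
have DXP M : DX M <-> forall N, Y N -> Ext_eq0 1 M (triv eta F_rex N).
  split=> [/(DeltaP FF0)[fm [Q [c [cP XQ]]]] N YN|MP].
    by apply/(Ext1_triv eta_assoc enough_proj _ fm cP); apply: XY_Ext1.
  have fm := Ext1_triv_mono eta_assoc enough_proj FF0 enough_inj injY MP.
  have [Q [c cP]] := ab_coker (ab_ax B) (str M).
  apply/(DeltaP FF0); split=> //; exists Q, c; split=> //.
  rewrite XE => N YN; apply/(Ext1_triv eta_assoc enough_proj _ fm cP).
  exact: MP.
(* By [DXP], [DX] is the left orthogonal of objects that themselves lie in [perp_r DX], so it equals
   the left orthogonal of [perp_r DX]. *)
have DX_triv N : Y N -> perp_r DX (triv eta F_rex N) by move=> YN M /DXP; apply.
have DX_pair : cotorsion_pair DX (perp_r DX).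
  split=> //; rewrite eqEsubset; split=> [M DM N|M MP]; first by apply.
  by apply/DXP => N YN; apply: MP; apply: DX_triv.
split=> // FX; split=> her.
  have clDX := hereditary_closed_coker enE DX_pair her.
  apply: Or44 => M N Q m c mm cP YM YN; rewrite YE => P XP.
  (* The free object on [P] lies in [DX] and has cokernel [P], so it turns Ext^1(P, Q) into Ext^1(T,
     (Q, 0)). *)
  have [T [i1 [i2 [p1 [p2 fT]]]]] := free_exists F_rex eta_assoc P.
  have [DT p1P] := Delta_free FF0 fT XP.
  have [Tm _] := (DeltaP FF0 _ _).1 DT.
  apply/(Ext1_triv eta_assoc enough_proj _ Tm p1P).
  have tm := triv_mono eta F_rex mm; have tcP := triv_coker eta F_rex cP.
  by apply: (clDX _ _ _ _ _ tm tcP) => //; apply: DX_triv.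
apply: Or43; apply: Delta_closed_ker => //.
have clY := hereditary_closed_coker enough_proj XY_cotorsion her.
exact: (closed_coker_closed_ker enough_proj enough_inj XY_cotorsion clY).
Qed.
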